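(* Let $\sigma\in(0,1)$ and $\lambda\in(0,\tfrac12)$ be any fixed constants and let $H:\mathbb{R}\to\mathbb{R}$. Then $H$ is a $C^2$ solution on $\mathbb{R}$ of the ODE $$(y'')^{+}-\sigma^{2}(y'')^{-}+xy'+2\lambda y=0$$ if and only if the function $$u^{H}(t,x)=(1+t)^{-\lambda}H\!\left(\frac{x}{\sqrt{1+t}}\right),\qquad (t,x)\in[0,+\infty)\times\mathbb{R},$$ is a solution of the $G$-heat equation $\partial_t u-G(\partial_{xx}^2u)=0$ on $[0,+\infty)\times\mathbb{R}$ with initial condition $u(0,x)=H(x)$.
   Context: For real $a$, $a^{+}=\max\{0,a\}$ and $a^{-}=(-a)^{+}$. For the given $\sigma$, $G(a)=\frac12(a^{+}-\sigma^{2}a^{-})$. Solutions of the $G$-heat equation are understood in the viscosity sense; since the equation is uniformly parabolic and $G$ is convex, it is a known fact (used as a convention) that solutions are of class $C^{1,2}$ and so satisfy the equation classically. *)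

(* Defs.v *)
From Stdlib Require Import Reals.
From Coquelicot Require Import Coquelicot.
Open Scope R_scope.

Definition pos_part (a : R) : R := Rmax 0 a.
Definition neg_part (a : R) : R := pos_part (- a).

Definition G (sigma a : R) : R :=
  / 2 * (pos_part a - sigma ^ 2 * neg_part a).

(* [Derive] is total, so each differentiability is asserted explicitly;
   [ex_derive_n H 2 x] alone would not imply [ex_derive H x]. *)
Definition C2 (H : R -> R) : Prop :=
  forall x : R,
    ex_derive H x /\ ex_derive (Derive H) x /\ continuous (Derive (Derive H)) x.

Definition C2_solution_ODE (sigma lambda : R) (y : R -> R) : Prop :=
  C2 y /\
  forall x : R,
    pos_part (Derive (Derive y) x) - sigma ^ 2 * neg_part (Derive (Derive y) x)
    + x * Derive y x + 2 * lambda * y x = 0.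

(* Functions on the closed half-plane [0,+oo) x R are represented by total
   functions [R -> R -> R] (time first) whose values at negative times never
   matter. *)

Definition D_t (phi : R -> R -> R) (t x : R) : R := Derive (fun s => phi s x) t.
Definition D_x (phi : R -> R -> R) (t x : R) : R := Derive (phi t) x.
Definition D_xx (phi : R -> R -> R) (t x : R) : R := Derive (Derive (phi t)) x.

(* Class C^{1,2} on the open half-plane (0,+oo) x R. Continuity of [phi] itself
   follows from that of [D_t phi] and [D_x phi]. *)
Definition C12 (phi : R -> R -> R) : Prop :=
  forall t x : R, 0 < t ->
    ex_derive (fun s => phi s x) t /\
    ex_derive (phi t) x /\
    ex_derive (Derive (phi t)) x /\
    continuity_2d_pt (D_t phi) t x /\
    continuity_2d_pt (D_x phi) t x /\
    continuity_2d_pt (D_xx phi) t x.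

Definition local_max_2d (w : R -> R -> R) (t x : R) : Prop :=
  locally_2d (fun s z => w s z <= w t x) t x.
Definition local_min_2d (w : R -> R -> R) (t x : R) : Prop :=
  locally_2d (fun s z => w t x <= w s z) t x.

(* Crandall-Ishii-Lions test-function inequalities on (0,+oo) x R. *)
Definition visc_sub_G_heat (sigma : R) (u : R -> R -> R) : Prop :=
  forall (phi : R -> R -> R) (t x : R),
    C12 phi -> 0 < t ->
    local_max_2d (fun s z => u s z - phi s z) t x ->
    D_t phi t x - G sigma (D_xx phi t x) <= 0.

Definition visc_super_G_heat (sigma : R) (u : R -> R -> R) : Prop :=
  forall (phi : R -> R -> R) (t x : R),
    C12 phi -> 0 < t ->
    local_min_2d (fun s z => u s z - phi s z) t x ->
    0 <= D_t phi t x - G sigma (D_xx phi t x).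

(* Joint continuity relative to [0,+oo) x R, hence one-sided in time at t = 0. *)
Definition continuous_on_half_plane (u : R -> R -> R) : Prop :=
  forall t x : R, 0 <= t ->
    filterlim (fun p : R * R => u (fst p) (snd p))
      (within (fun p : R * R => 0 <= fst p) (locally (t, x)))
      (locally (u t x)).

(* Viscosity solution of the Cauchy problem
     u_t - G(u_xx) = 0 on [0,+oo) x R,   u(0,.) = u0;
   the equation is tested at positive times and u is continuous up to t = 0. *)
Definition G_heat_solution (sigma : R) (u0 : R -> R) (u : R -> R -> R) : Prop :=
  continuous_on_half_plane u /\
  visc_sub_G_heat sigma u /\
  visc_super_G_heat sigma u /\
  forall x : R, u 0 x = u0 x.

Definition uH (lambda : R) (H : R -> R) (t x : R) : R :=
  Rpower (1 + t) (- lambda) * H (x / sqrt (1 + t)).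

(* Main.v *)
(* For a C2 profile, the heat operator applied to [uH] is a positive multiple of
   the ODE residual, so an ODE solution gives a classical, hence viscosity,
   solution. Conversely, test functions of the form [uH phi] show that [H] is a
   viscosity solution of the ODE, and the point is that such a solution is C2.
   One-dimensional barriers give this in three steps: an exponential barrier
   makes [H] locally Lipschitz, so the first-order term is bounded; parabolas
   above and below the chords then make [H] locally C^{1,1}; finally, with
   [Y'' = F^{-1} (- x H' - 2 lambda H)], now continuous, both [H - Y] and
   [Y - H] are convex, so [H] differs from the C2 function [Y] by an affine one. *)

Require Import Defs.
From Stdlib Require Import Reals Lra.
From Coquelicot Require Import Coquelicot.
Open Scope R_scope.

(** * Self-similar functions *)

(** The nonlinearity of the ODE: piecewise linear, with slope 1 on the positive side and [sigma ^ 2]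
    on the negative side. *)
Definition F (sigma a : R) : R := pos_part a - sigma ^ 2 * neg_part a.

Lemma G_F sigma a : G sigma a = / 2 * F sigma a.
Proof. reflexivity. Qed.

Lemma F_nonneg sigma a : 0 <= a -> F sigma a = a.
Proof.
  intros Ha; unfold F, neg_part, pos_part.
  rewrite Rmax_right, Rmax_left by lra; ring.
Qed.

Lemma F_nonpos sigma a : a <= 0 -> F sigma a = sigma ^ 2 * a.
Proof.
  intros Ha; unfold F, neg_part, pos_part.
  rewrite Rmax_left, Rmax_right by lra; ring.
Qed.

Lemma F_scale sigma c a : 0 <= c -> F sigma (c * a) = c * F sigma a.
Proof.
  intros Hc; destruct (Rle_dec 0 a).
  - rewrite !F_nonneg; try lra. now apply Rmult_le_pos.
  - rewrite !F_nonpos; try nra.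
Qed.

Lemma F_increasing sigma a b : 0 < sigma < 1 -> a < b -> F sigma a < F sigma b.
Proof.
  intros Hs Hab; assert (0 < sigma ^ 2) by nra.
  destruct (Rle_dec 0 a); destruct (Rle_dec 0 b);
    rewrite ?(F_nonneg _ a), ?(F_nonneg _ b), ?(F_nonpos _ a), ?(F_nonpos _ b) by lra; nra.
Qed.

Lemma F_le sigma a b : 0 < sigma < 1 -> a <= b -> F sigma a <= F sigma b.
Proof.
  intros Hs [Hab| ->]; [left; now apply F_increasing | lra].
Qed.

Lemma ex_derive_continuity_pt (f : R -> R) x : ex_derive f x -> continuity_pt f x.
Proof.
  intros Hf; apply continuity_pt_filterlim; now apply (ex_derive_continuous f).
Qed.

Lemma Rpower_gt_0 x y : 0 < Rpower x y.
Proof. apply exp_pos. Qed.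

Lemma is_derive_Rpower_time lambda t : -1 < t ->
  is_derive (fun s => Rpower (1 + s) (- lambda)) t
    (- lambda * Rpower (1 + t) (- lambda) / (1 + t)).
Proof.
  intros Ht; unfold Rpower; auto_derive; [lra | field; lra].
Qed.

Lemma is_derive_inv_sqrt_time x t : -1 < t ->
  is_derive (fun s => x / sqrt (1 + s)) t (- (x / sqrt (1 + t)) / 2 / (1 + t)).
Proof.
  intros Ht; assert (0 < sqrt (1 + t)) by (apply sqrt_lt_R0; lra).
  auto_derive; [repeat split; lra|].
  (* Writing the bare [1 + t] as the square of its root leaves an identity that is rational in
     [sqrt (1 + t)]. *)
  rewrite <- (sqrt_sqrt (1 + t)) at 5 by lra.
  field; lra.
Qed.

Section SelfSimilar.

Variables (lambda : R) (phi : R -> R).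
Hypothesis Hphi : C2 phi.

Lemma C2_is_derive x : is_derive phi x (Derive phi x).
Proof. apply Derive_correct, Hphi. Qed.

Lemma is_derive_t_uH t x : -1 < t ->
  is_derive (fun s => uH lambda phi s x) t
    (- Rpower (1 + t) (- lambda) / (1 + t) *
       (lambda * phi (x / sqrt (1 + t))
        + / 2 * (x / sqrt (1 + t)) * Derive phi (x / sqrt (1 + t)))).
Proof.
  intros Ht; unfold uH.
  evar_last.
  { apply @is_derive_mult.
    - now apply is_derive_Rpower_time.
    - apply @is_derive_comp; [apply C2_is_derive | now apply is_derive_inv_sqrt_time].
    - intros; apply Rmult_comm. }
  unfold plus, scal, mult; simpl; unfold mult; simpl.
  field; split; [apply Rgt_not_eq, sqrt_lt_R0|]; lra.
Qed.

Lemma is_derive_x_uH t x : -1 < t ->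
  is_derive (uH lambda phi t) x
    (Rpower (1 + t) (- lambda) / sqrt (1 + t) * Derive phi (x / sqrt (1 + t))).
Proof.
  intros Ht; unfold uH.
  assert (0 < sqrt (1 + t)) by (apply sqrt_lt_R0; lra).
  auto_derive; [apply Hphi|].
  change (Derive (fun z => phi z)) with (Derive phi); unfold Rdiv; ring.
Qed.

Lemma Derive_x_uH t x : -1 < t ->
  Derive (uH lambda phi t) x =
  Rpower (1 + t) (- lambda) / sqrt (1 + t) * Derive phi (x / sqrt (1 + t)).
Proof. intros Ht; now apply is_derive_unique, is_derive_x_uH. Qed.

Lemma is_derive_xx_uH t x : -1 < t ->
  is_derive (Derive (uH lambda phi t)) x
    (Rpower (1 + t) (- lambda) / (1 + t) * Derive (Derive phi) (x / sqrt (1 + t))).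
Proof.
  intros Ht.
  apply is_derive_ext with
    (fun y => Rpower (1 + t) (- lambda) / sqrt (1 + t) * Derive phi (y / sqrt (1 + t))).
  { intros y; now rewrite Derive_x_uH. }
  assert (0 < sqrt (1 + t)) by (apply sqrt_lt_R0; lra).
  auto_derive; [apply Hphi|].
  change (Derive (fun z => Derive phi z)) with (Derive (Derive phi)).
  assert (Hinv : / (1 + t) = / sqrt (1 + t) * / sqrt (1 + t))
    by (rewrite <- Rinv_mult, sqrt_sqrt; lra).
  unfold Rdiv; rewrite Hinv; ring.
Qed.

Lemma continuity_2d_time (g : R -> R) t x :
  continuity_pt g t -> continuity_2d_pt (fun s _ => g s) t x.
Proof.
  intros Hg; apply (continuity_1d_2d_pt_comp g (fun s _ => s)); [exact Hg|].
  apply continuity_2d_pt_id1.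
Qed.

(** [uH] and its derivatives all have this shape, a factor in time times a profile in the similarity
    variable, so every joint continuity below reduces to one-variable continuity. *)
Lemma continuity_2d_profile (a b : R -> R) t x : -1 < t ->
  continuity_pt a t -> continuity_pt b (x / sqrt (1 + t)) ->
  continuity_2d_pt (fun s y => a s * b (y / sqrt (1 + s))) t x.
Proof.
  intros Ht Ha Hb.
  apply continuity_2d_pt_mult; [now apply continuity_2d_time|].
  apply (continuity_1d_2d_pt_comp b (fun s y => y / sqrt (1 + s))); [exact Hb|].
  apply continuity_2d_pt_mult; [apply continuity_2d_pt_id2|].
  apply (continuity_2d_time (fun s => / sqrt (1 + s))).
  apply ex_derive_continuity_pt.
  assert (0 < sqrt (1 + t)) by (apply sqrt_lt_R0; lra).
  auto_derive; repeat split; lra.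
Qed.

Lemma locally_2d_positive_time (P : R -> R -> Prop) t x : 0 < t ->
  (forall s y, 0 < s -> P s y) -> locally_2d P t x.
Proof.
  intros Ht HP; exists (mkposreal t Ht); simpl; intros s y Hs _.
  apply HP; apply Rabs_def2 in Hs; lra.
Qed.

(** Serves twice: with [H] itself as profile, for classical solutions, and with a one-dimensional
    test function as profile, which makes [uH] an admissible test function. *)
Lemma C12_uH : C12 (uH lambda phi).
Proof.
  intros t x Ht.
  assert (0 < sqrt (1 + t)) by (apply sqrt_lt_R0; lra).
  assert (H1 : continuity_pt phi (x / sqrt (1 + t))).
  { apply ex_derive_continuity_pt, Hphi. }
  assert (H2 : continuity_pt (Derive phi) (x / sqrt (1 + t))).
  { apply ex_derive_continuity_pt, Hphi. }
  repeat split.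
  - eexists; apply is_derive_t_uH; lra.
  - eexists; apply is_derive_x_uH; lra.
  - eexists; apply is_derive_xx_uH; lra.
  - apply continuity_2d_pt_ext_loc with
      (fun s y => - Rpower (1 + s) (- lambda) / (1 + s) *
         ((fun z => lambda * phi z + / 2 * z * Derive phi z) (y / sqrt (1 + s)))).
    { apply locally_2d_positive_time; [exact Ht|]; intros s y Hs; unfold D_t.
      symmetry; apply is_derive_unique, is_derive_t_uH; lra. }
    apply (continuity_2d_profile (fun s => - Rpower (1 + s) (- lambda) / (1 + s))
             (fun z => lambda * phi z + / 2 * z * Derive phi z)); [lra| |].
    + apply ex_derive_continuity_pt; unfold Rpower; auto_derive; repeat split; lra.
    + apply continuity_pt_plus; apply continuity_pt_mult; auto.
      * apply continuity_pt_const; now intros ? ?.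
      * apply continuity_pt_mult; [apply continuity_pt_const; now intros ? ?|].
        apply continuity_pt_id.
  - apply continuity_2d_pt_ext_loc with
      (fun s y => Rpower (1 + s) (- lambda) / sqrt (1 + s) * Derive phi (y / sqrt (1 + s))).
    { apply locally_2d_positive_time; [exact Ht|]; intros s y Hs; unfold D_x.
      symmetry; apply Derive_x_uH; lra. }
    apply (continuity_2d_profile (fun s => Rpower (1 + s) (- lambda) / sqrt (1 + s)));
      [lra| |exact H2].
    apply ex_derive_continuity_pt; unfold Rpower; auto_derive; repeat split; lra.
  - apply continuity_2d_pt_ext_loc with
      (fun s y => Rpower (1 + s) (- lambda) / (1 + s) * Derive (Derive phi) (y / sqrt (1 + s))).
    { apply locally_2d_positive_time; [exact Ht|]; intros s y Hs; unfold D_xx.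
      symmetry; apply is_derive_unique, is_derive_xx_uH; lra. }
    apply (continuity_2d_profile (fun s => Rpower (1 + s) (- lambda) / (1 + s)));
      [lra| |].
    + apply ex_derive_continuity_pt; unfold Rpower; auto_derive; repeat split; lra.
    + apply continuity_pt_filterlim, Hphi.
Qed.

(** [F] is positively homogeneous, so the common time factor comes out of it. The factor in front of
    the ODE residual is negative: a nonpositive heat operator corresponds to a nonnegative
    residual. *)
Lemma G_heat_operator_uH sigma t x : -1 < t ->
  D_t (uH lambda phi) t x - G sigma (D_xx (uH lambda phi) t x) =
  - (Rpower (1 + t) (- lambda) / (1 + t) / 2) *
    (F sigma (Derive (Derive phi) (x / sqrt (1 + t)))
     + x / sqrt (1 + t) * Derive phi (x / sqrt (1 + t))
     + 2 * lambda * phi (x / sqrt (1 + t))).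
Proof.
  intros Ht.
  pose proof (is_derive_unique _ _ _ (is_derive_t_uH t x Ht)) as Et.
  pose proof (is_derive_unique _ _ _ (is_derive_xx_uH t x Ht)) as Exx.
  unfold D_t, D_xx; simpl in Et, Exx; rewrite Et, Exx.
  rewrite G_F, F_scale.
  - field; split; [apply Rgt_not_eq, sqrt_lt_R0|]; lra.
  - left; apply Rdiv_lt_0_compat; [apply Rpower_gt_0 | lra].
Qed.

End SelfSimilar.

(** * Classical solutions are viscosity solutions *)

Lemma continuous_on_half_plane_uH lambda (H : R -> R) :
  (forall x, continuity_pt H x) -> continuous_on_half_plane (uH lambda H).
Proof.
  intros HH t x Ht.
  (* The formula makes sense for all times above -1, so even at time 0 the two-sided continuity
     holds and implies the one-sided one. *)
  eapply filterlim_filter_le_1; [apply filter_le_within|].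
  apply (continuity_2d_pt_filterlim (uH lambda H)).
  apply (continuity_2d_profile (fun s => Rpower (1 + s) (- lambda))); [lra| |apply HH].
  apply ex_derive_continuity_pt; eexists; apply is_derive_Rpower_time; lra.
Qed.

Lemma uH_0 lambda (H : R -> R) x : uH lambda H 0 x = H x.
Proof.
  unfold uH; rewrite Rplus_0_r, sqrt_1, Rdiv_1_r.
  unfold Rpower; rewrite ln_1, Rmult_0_r, exp_0; ring.
Qed.

(** The slice of [uH] at time 0 is [H], and the map sending [y] to [(0, y)] stays in the closed
    half-plane. *)
Lemma continuity_of_half_plane lambda (H : R -> R) :
  continuous_on_half_plane (uH lambda H) -> forall x, continuity_pt H x.
Proof.
  intros Hu x; apply continuity_pt_filterlim.
  specialize (Hu 0 x (Rle_refl 0)); rewrite uH_0 in Hu.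
  apply filterlim_ext with (fun y => uH lambda H 0 y); [intros; apply uH_0|].
  refine (filterlim_comp _ _ _ (fun y : R => (0, y)) _ _ _ _ _ Hu).
  intros P [d Hd]; exists d; intros y Hy.
  apply Hd; [|simpl; lra].
  split; [apply ball_center | exact Hy].
Qed.

Lemma Derive_eq0_local_max (f : R -> R) x :
  ex_derive f x -> locally x (fun y => f y <= f x) -> Derive f x = 0.
Proof.
  intros Hf [d Hd].
  assert (pr : derivable_pt f x) by now apply ex_derive_Reals_0.
  rewrite <- (Derive_Reals f x pr).
  pose proof (cond_pos d).
  apply (deriv_maximum f (x - d) (x + d)); try lra.
  intros y Hy1 Hy2; apply Hd; apply Rabs_def1; unfold minus, plus, opp; simpl; lra.
Qed.

(** Since the first derivative vanishes at [x], a positive second derivative would make it positive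
    just to the right of [x]; by the mean value theorem [f] would then exceed its local maximum. *)
Lemma Derive2_le0_local_max (f : R -> R) x :
  (forall y, ex_derive f y) -> ex_derive (Derive f) x ->
  locally x (fun y => f y <= f x) -> Derive (Derive f) x <= 0.
Proof.
  intros Hf Hf2 Hloc.
  pose proof (Derive_eq0_local_max f x (Hf x) Hloc) as Hf0.
  apply Rnot_lt_le; intros Hpos.
  pose proof (proj1 (is_derive_Reals _ _ _) (Derive_correct _ _ Hf2) _ Hpos) as [d1 Hd1].
  destruct Hloc as [d2 Hd2].
  set (h := Rmin d1 d2 / 2).
  assert (Hh : 0 < h < d1 /\ h < d2).
  { pose proof (cond_pos d1); pose proof (cond_pos d2).
    unfold h; pose proof (Rmin_l d1 d2); pose proof (Rmin_r d1 d2).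
    assert (0 < Rmin d1 d2) by (apply Rmin_glb_lt; lra). lra. }
  assert (Hinc : forall y, x < y <= x + h -> 0 < Derive f y).
  { intros y Hy.
    assert (Hy' : Rabs (y - x) < d1) by (apply Rabs_def1; lra).
    specialize (Hd1 (y - x) ltac:(lra) Hy').
    replace (x + (y - x)) with y in Hd1 by ring.
    rewrite Hf0, Rminus_0_r in Hd1; apply Rabs_def2 in Hd1.
    replace (Derive f y) with (Derive f y / (y - x) * (y - x)) by (field; lra).
    apply Rmult_lt_0_compat; lra. }
  destruct (MVT_cor2 f (Derive f) x (x + h)) as [c [Hc1 Hc2]]; [lra| |].
  { intros c _; apply is_derive_Reals, Derive_correct, Hf. }
  specialize (Hinc c ltac:(lra)).
  assert (Hle : f (x + h) <= f x).
  { apply Hd2; apply Rabs_def1; unfold minus, plus, opp; simpl; lra. }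
  nra.
Qed.

Lemma C12_local_max_D_t u phi t x : C12 u -> C12 phi -> 0 < t ->
  local_max_2d (fun s z => u s z - phi s z) t x -> D_t u t x = D_t phi t x.
Proof.
  intros Hu Hphi Ht Hmax.
  destruct (Hu t x Ht) as [Hut _]; destruct (Hphi t x Ht) as [Hpt _].
  apply locally_2d_1d_const_y in Hmax.
  apply (Derive_eq0_local_max (fun s => u s x - phi s x)) in Hmax.
  - rewrite (Derive_minus (fun s => u s x) (fun s => phi s x) t Hut Hpt) in Hmax.
    apply Rminus_diag_uniq; exact Hmax.
  - exact (ex_derive_minus (fun s => u s x) (fun s => phi s x) t Hut Hpt).
Qed.

Lemma C12_local_max_D_xx u phi t x : C12 u -> C12 phi -> 0 < t ->
  local_max_2d (fun s z => u s z - phi s z) t x -> D_xx u t x <= D_xx phi t x.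
Proof.
  intros Hu Hphi Ht Hmax.
  assert (Hux : forall y, ex_derive (u t) y) by (intros y; apply (Hu t y Ht)).
  assert (Hpx : forall y, ex_derive (phi t) y) by (intros y; apply (Hphi t y Ht)).
  destruct (Hu t x Ht) as (_ & _ & Huxx & _).
  destruct (Hphi t x Ht) as (_ & _ & Hpxx & _).
  assert (HD : forall y, Derive (fun z => u t z - phi t z) y =
                         Derive (u t) y - Derive (phi t) y).
  { intros y; apply (Derive_minus (u t) (phi t)); auto. }
  apply locally_2d_1d_const_x, (Derive2_le0_local_max (fun z => u t z - phi t z)) in Hmax.
  - rewrite (Derive_ext _ _ _ HD), (Derive_minus _ _ x Huxx Hpxx) in Hmax.
    unfold D_xx; apply Rminus_le; exact Hmax.
  - intros y; apply (ex_derive_minus (u t) (phi t)); auto.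
  - apply (ex_derive_ext (fun y => Derive (u t) y - Derive (phi t) y));
      [intros; now rewrite HD|].
    now apply (ex_derive_minus (Derive (u t)) (Derive (phi t))).
Qed.

Lemma local_min_2d_max u phi t x :
  local_min_2d (fun s z => u s z - phi s z) t x <->
  local_max_2d (fun s z => phi s z - u s z) t x.
Proof.
  split; intros [d Hd]; exists d; intros s z Hs Hz; specialize (Hd s z Hs Hz); simpl in *; lra.
Qed.

(** Ellipticity: at the maximum of [u - phi] the time derivatives agree and the second space
    derivatives are ordered, and [G] is monotone. *)
Lemma classical_visc_sub sigma u : 0 < sigma < 1 -> C12 u ->
  (forall t x, 0 < t -> D_t u t x - G sigma (D_xx u t x) <= 0) ->
  visc_sub_G_heat sigma u.
Proof.
  intros Hs Hu Hsub phi t x Hphi Ht Hmax.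
  rewrite <- (C12_local_max_D_t u phi) by assumption.
  specialize (Hsub t x Ht).
  assert (Hle := F_le sigma _ _ Hs (C12_local_max_D_xx u phi t x Hu Hphi Ht Hmax)).
  rewrite G_F in *; lra.
Qed.

Lemma classical_visc_super sigma u : 0 < sigma < 1 -> C12 u ->
  (forall t x, 0 < t -> 0 <= D_t u t x - G sigma (D_xx u t x)) ->
  visc_super_G_heat sigma u.
Proof.
  intros Hs Hu Hsuper phi t x Hphi Ht Hmin%local_min_2d_max.
  (* A minimum of [u - phi] is a maximum of [phi - u], so the two functions exchange roles. *)
  rewrite (C12_local_max_D_t phi u) by assumption.
  specialize (Hsuper t x Ht).
  assert (Hle := F_le sigma _ _ Hs (C12_local_max_D_xx phi u t x Hphi Hu Ht Hmin)).
  rewrite G_F in *; lra.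
Qed.

Lemma G_heat_solution_of_ODE sigma lambda H : 0 < sigma < 1 ->
  C2_solution_ODE sigma lambda H -> G_heat_solution sigma H (uH lambda H).
Proof.
  intros Hs [HC2 Hode].
  assert (Heq : forall t x, 0 < t ->
            D_t (uH lambda H) t x - G sigma (D_xx (uH lambda H) t x) = 0).
  { intros t x Ht; rewrite G_heat_operator_uH by (assumption || lra).
    unfold F; rewrite Hode; ring. }
  split; [|split; [|split]].
  - apply continuous_on_half_plane_uH; intros x; now apply ex_derive_continuity_pt, HC2.
  - apply classical_visc_sub; [assumption|now apply C12_uH|].
    intros; rewrite Heq; lra.
  - apply classical_visc_super; [assumption|now apply C12_uH|].
    intros; rewrite Heq; lra.
  - intros x; apply uH_0.
Qed.

(** * Viscosity solutions of the ODE *)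

(** [Phi] is a parameter so that supersolutions are covered too: [H] is a supersolution for
    [F sigma] when [- H] is a subsolution for the reflected nonlinearity [fun a => - F sigma (- a)].
    The zeroth-order term contains [y x], so adding a constant to [phi] changes nothing. *)
Definition visc_sub_ODE (Phi : R -> R) (lambda : R) (y : R -> R) : Prop :=
  forall (phi : R -> R) (x : R), C2 phi ->
    locally x (fun z => y z - phi z <= y x - phi x) ->
    0 <= Phi (Derive (Derive phi) x) + x * Derive phi x + 2 * lambda * y x.

Lemma C2_intro (f f1 f2 : R -> R) :
  (forall x, is_derive f x (f1 x)) -> (forall x, is_derive f1 x (f2 x)) ->
  (forall x, continuous f2 x) ->
  C2 f /\ (forall x, Derive f x = f1 x) /\ (forall x, Derive (Derive f) x = f2 x).
Proof.
  intros H1 H2 H3.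
  assert (E1 : forall x, Derive f x = f1 x) by (intros; now apply is_derive_unique).
  assert (E2 : forall x, Derive (Derive f) x = f2 x).
  { intros x; rewrite (Derive_ext _ _ _ E1); now apply is_derive_unique. }
  split; [|split]; auto.
  intros x; split; [|split].
  - now exists (f1 x).
  - apply (ex_derive_ext f1); [intros; now rewrite E1 | now exists (f2 x)].
  - apply continuous_ext with f2; [intros; now rewrite E2 | apply H3].
Qed.

(** With [a = 1] it moves a test function until it touches; with [a = -1] it performs the reflection
    that exchanges sub- and supersolutions. *)
Lemma C2_scal_shift (phi : R -> R) a b : C2 phi ->
  C2 (fun z => a * phi z + b) /\
  (forall x, Derive (fun z => a * phi z + b) x = a * Derive phi x) /\
  (forall x, Derive (Derive (fun z => a * phi z + b)) x = a * Derive (Derive phi) x).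
Proof.
  intros Hphi; apply C2_intro.
  - intros x; auto_derive; [apply Hphi|now rewrite Rmult_1_l].
  - intros x; auto_derive; [apply Hphi|now rewrite Rmult_1_l].
  - intros x; apply (continuous_scal_r a (Derive (Derive phi))), Hphi.
Qed.

(** The difference is a positive time factor times [f - g] at the similarity variable. Contact at
    [x] makes it 0 at the base point and nonpositive nearby, whatever the time factor does. *)
Lemma uH_touching lambda (f g : R -> R) t x : 0 < t ->
  f x = g x -> locally x (fun z => f z <= g z) ->
  local_max_2d (fun s z => uH lambda f s z - uH lambda g s z) t (x * sqrt (1 + t)).
Proof.
  intros Ht Hx [d Hd].
  assert (Hr : 0 < sqrt (1 + t)) by (apply sqrt_lt_R0; lra).
  assert (E : x * sqrt (1 + t) / sqrt (1 + t) = x) by (field; lra).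
  (* Continuity of the similarity variable; the factor 1 fits it to the shape of
     [continuity_2d_profile]. *)
  assert (Hc : continuity_2d_pt (fun s y => 1 * (y / sqrt (1 + s))) t (x * sqrt (1 + t))).
  { apply (continuity_2d_profile (fun _ => 1) (fun z => z)); [lra| |].
    - apply continuity_pt_const; now intros ? ?.
    - apply continuity_pt_id. }
  destruct (Hc d) as [d' Hd']; exists d'; intros s y Hs Hy.
  specialize (Hd' s y Hs Hy); rewrite !Rmult_1_l, E in Hd'.
  specialize (Hd _ Hd').
  unfold uH; rewrite E, Hx.
  pose proof (Rpower_gt_0 (1 + s) (- lambda)); nra.
Qed.

Lemma visc_sub_ODE_of_uH sigma lambda (H : R -> R) :
  visc_sub_G_heat sigma (uH lambda H) -> visc_sub_ODE (F sigma) lambda H.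
Proof.
  intros Hsub phi x Hphi [d Hd].
  destruct (C2_scal_shift phi 1 (H x - phi x) Hphi) as (Hpsi & E1 & E2).
  set (psi := fun z => 1 * phi z + (H x - phi x)) in *.
  (* Any positive time would do; at time 1 the point [x * sqrt (1 + 1)] has similarity variable
     [x]. *)
  assert (Hmax : local_max_2d (fun s z => uH lambda H s z - uH lambda psi s z)
                   1 (x * sqrt (1 + 1))).
  { apply uH_touching; [lra|unfold psi; lra|].
    exists d; intros y Hy; specialize (Hd y Hy); unfold psi; simpl in *; lra. }
  specialize (Hsub _ _ _ (C12_uH lambda psi Hpsi) Rlt_0_1 Hmax).
  rewrite G_heat_operator_uH in Hsub by (assumption || lra).
  assert (Hr : 0 < sqrt (1 + 1)) by (apply sqrt_lt_R0; lra).
  replace (x * sqrt (1 + 1) / sqrt (1 + 1)) with x in Hsub by (field; lra).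
  rewrite E1, E2, !Rmult_1_l in Hsub.
  replace (psi x) with (H x) in Hsub by (unfold psi; lra).
  pose proof (Rpower_gt_0 (1 + 1) (- lambda)).
  assert (0 < Rpower (1 + 1) (- lambda) / (1 + 1) / 2) by lra.
  nra.
Qed.

Lemma visc_super_ODE_of_uH sigma lambda (H : R -> R) :
  visc_super_G_heat sigma (uH lambda H) ->
  visc_sub_ODE (fun a => - F sigma (- a)) lambda (fun z => - H z).
Proof.
  intros Hsuper phi x Hphi [d Hd].
  destruct (C2_scal_shift phi (-1) (H x + phi x) Hphi) as (Hpsi & E1 & E2).
  (* The reflection of [phi], shifted so that it touches [H] from below at [x]. *)
  set (psi := fun z => -1 * phi z + (H x + phi x)) in *.
  assert (Hmax : local_max_2d (fun s z => uH lambda psi s z - uH lambda H s z)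
                   1 (x * sqrt (1 + 1))).
  { apply uH_touching; [lra|unfold psi; lra|].
    exists d; intros y Hy; specialize (Hd y Hy); unfold psi; simpl in *; lra. }
  apply <- local_min_2d_max in Hmax.
  specialize (Hsuper _ _ _ (C12_uH lambda psi Hpsi) Rlt_0_1 Hmax).
  rewrite G_heat_operator_uH in Hsuper by (assumption || lra).
  assert (Hr : 0 < sqrt (1 + 1)) by (apply sqrt_lt_R0; lra).
  replace (x * sqrt (1 + 1) / sqrt (1 + 1)) with x in Hsuper by (field; lra).
  rewrite E1, E2 in Hsuper.
  replace (psi x) with (H x) in Hsuper by (unfold psi; lra).
  pose proof (Rpower_gt_0 (1 + 1) (- lambda)).
  assert (0 < Rpower (1 + 1) (- lambda) / (1 + 1) / 2) by lra.
  replace (- Derive (Derive phi) x) with (-1 * Derive (Derive phi) x) by ring.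
  nra.
Qed.

(** * Comparison and barrier estimates *)

(** If [y] exceeded [phi] somewhere, the maximum of [y - phi] would be positive, hence interior, and
    testing with [phi] there would contradict strictness. Strictness is asked only at local maxima
    of [y - phi], where the derivatives of [y] and [phi] coincide once [y] is differentiable. *)
Lemma visc_sub_ODE_comparison Phi lambda (y phi : R -> R) x1 x2 :
  visc_sub_ODE Phi lambda y -> (forall x, continuity_pt y x) -> C2 phi -> x1 <= x2 ->
  y x1 <= phi x1 -> y x2 <= phi x2 ->
  (forall z, x1 < z < x2 -> locally z (fun v => y v - phi v <= y z - phi z) ->
     Phi (Derive (Derive phi) z) + z * Derive phi z + 2 * lambda * y z < 0) ->
  forall z, x1 <= z <= x2 -> y z <= phi z.
Proof.
  intros Hsub Hc Hphi H12 Hl Hr Hstrict z Hz.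
  destruct (continuity_ab_maj (fun v => y v - phi v) x1 x2 H12) as [m [Hm Hmi]].
  { intros c _; apply continuity_pt_minus; [apply Hc|].
    apply ex_derive_continuity_pt, Hphi. }
  apply Rnot_lt_le; intros Hlt.
  pose proof (Hm z Hz) as Hmz.
  assert (Hin : x1 < m < x2).
  { split; apply Rnot_le_lt; intros Hle.
    - replace m with x1 in Hmz by lra; lra.
    - replace m with x2 in Hmz by lra; lra. }
  assert (Hloc : locally m (fun v => y v - phi v <= y m - phi m)).
  { assert (Hd : 0 < Rmin (m - x1) (x2 - m)) by (apply Rmin_glb_lt; lra).
    exists (mkposreal _ Hd); intros v Hv.
    apply Hm; apply Rabs_def2 in Hv; unfold minus, plus, opp in Hv; simpl in Hv.
    pose proof (Rmin_l (m - x1) (x2 - m)); pose proof (Rmin_r (m - x1) (x2 - m)); lra. }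
  pose proof (Hsub phi m Hphi Hloc).
  pose proof (Hstrict m Hin Hloc); lra.
Qed.

Lemma continuity_bounded (f : R -> R) a b : (forall x, continuity_pt f x) ->
  exists M, 0 < M /\ forall x, a <= x <= b -> Rabs (f x) <= M.
Proof.
  intros Hf; destruct (Rle_dec a b) as [Hab|Hab].
  - destruct (continuity_ab_maj (fun x => Rabs (f x)) a b Hab) as [m [Hm _]].
    { intros c _; apply (continuity_pt_comp f Rabs); [apply Hf|apply Rcontinuity_abs]. }
    exists (Rabs (f m) + 1); split; [pose proof (Rabs_pos (f m)); lra|].
    intros x Hx; specialize (Hm x Hx); simpl in Hm; lra.
  - exists 1; split; [lra|]; intros; lra.
Qed.

Lemma C2_exp_barrier c A k x0 :
  C2 (fun z => c + A * (1 - exp (- k * (z - x0)))) /\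
  (forall x, Derive (fun z => c + A * (1 - exp (- k * (z - x0)))) x =
             A * k * exp (- k * (x - x0))) /\
  (forall x, Derive (Derive (fun z => c + A * (1 - exp (- k * (z - x0))))) x =
             - (A * k ^ 2 * exp (- k * (x - x0)))).
Proof.
  apply C2_intro.
  - intros x; auto_derive; [trivial|unfold Rminus; ring].
  - intros x; auto_derive; [trivial|unfold Rminus; ring].
  - intros x; apply (ex_derive_continuous (fun z => - (A * k ^ 2 * exp (- k * (z - x0))))).
    auto_derive; trivial.
Qed.

(** An affine function plus a parabola vanishing at [x1] and [x2], added to [Y]. It is used with
    [Y = 0] for semiconvexity, with a second primitive as [Y] for convexity, and with [C = 0] for
    the final affine correction. *)
Lemma C2_quadratic_barrier (Y : R -> R) c m C x1 x2 : C2 Y ->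
  C2 (fun z => Y z + (c + m * (z - x1) + C * ((z - x1) * (x2 - z)))) /\
  (forall x, Derive (fun z => Y z + (c + m * (z - x1) + C * ((z - x1) * (x2 - z)))) x =
             Derive Y x + (m + C * (x1 + x2 - 2 * x))) /\
  (forall x,
     Derive (Derive (fun z => Y z + (c + m * (z - x1) + C * ((z - x1) * (x2 - z))))) x =
     Derive (Derive Y) x + - 2 * C).
Proof.
  intros HY; apply C2_intro.
  - intros x; auto_derive; [apply HY|].
    change (Derive (fun z => Y z)) with (Derive Y); ring.
  - intros x; auto_derive; [apply HY|].
    change (Derive (fun z => Derive Y z)) with (Derive (Derive Y)); ring.
  - intros x; apply (continuous_plus (Derive (Derive Y)) (fun _ => - 2 * C)).
    + apply HY.
    + apply continuous_const.
Qed.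

(* [1 - exp (- k (z - x0))] is so concave for [k] large that the first-order
   term, of unknown sign, is absorbed: its multiples are strict supersolutions. *)
Lemma visc_sub_ODE_upper_lipschitz Phi s lambda (y : R -> R) N :
  0 < s -> (forall a, a <= 0 -> Phi a <= s * a) ->
  visc_sub_ODE Phi lambda y -> (forall x, continuity_pt y x) -> 0 < N ->
  exists L, forall x0 x, - N <= x0 <= N -> x0 <= x <= x0 + 1 ->
    y x - y x0 <= L * (x - x0).
Proof.
  intros Hs HPhi Hsub Hc HN.
  destruct (continuity_bounded y (- N) (N + 1) Hc) as [M [HM HyM]].
  set (B := Rabs (2 * lambda) * M).
  (* Then [s * k = N + 2] exceeds every [z <= N + 1] by at least 1: the second- and first-order
     terms of the barrier sum to at most minus its slope, itself at least [A * k * exp (- k)]. *)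
  set (k := (N + 2) / s).
  assert (Hk : 0 < k) by (apply Rdiv_lt_0_compat; lra).
  assert (Hsk : s * k = N + 2) by (unfold k; field; lra).
  assert (He1 : exp (- k) < 1) by (rewrite <- exp_0; apply exp_increasing; lra).
  assert (He0 := exp_pos (- k)).
  assert (HB : 0 <= B) by (apply Rmult_le_pos; [apply Rabs_pos|lra]).
  (* The first summand makes the slope dominate the zeroth-order term, bounded by [B]; the second
     lifts the barrier by [2 * M] at [x0 + 1], hence above [y] there. *)
  set (A := (B + 1) / (k * exp (- k)) + 2 * M / (1 - exp (- k))).
  assert (Hke : 0 < k * exp (- k)) by now apply Rmult_lt_0_compat.
  assert (HA1 : 0 < (B + 1) / (k * exp (- k))) by (apply Rdiv_lt_0_compat; lra).
  assert (HA2 : 0 < 2 * M / (1 - exp (- k))) by (apply Rdiv_lt_0_compat; lra).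
  assert (HA : 0 < A) by (unfold A; lra).
  assert (HAB : B < A * k * exp (- k)).
  { assert (E : (B + 1) / (k * exp (- k)) * (k * exp (- k)) = B + 1) by (field; lra).
    unfold A; nra. }
  assert (HAM : 2 * M <= A * (1 - exp (- k))).
  { assert (E : 2 * M / (1 - exp (- k)) * (1 - exp (- k)) = 2 * M) by (field; lra).
    unfold A; nra. }
  exists (A * k); intros x0 x Hx0 Hx.
  destruct (C2_exp_barrier (y x0) A k x0) as (HC2 & E1 & E2).
  set (phi := fun z => y x0 + A * (1 - exp (- k * (z - x0)))) in *.
  assert (Hle : y x <= phi x).
  { apply (visc_sub_ODE_comparison Phi lambda y phi x0 (x0 + 1)); auto; try lra.
    - unfold phi; replace (- k * (x0 - x0)) with 0 by ring; rewrite exp_0; lra.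
    - unfold phi; replace (- k * (x0 + 1 - x0)) with (- k) by ring.
      pose proof (HyM x0 ltac:(lra)) as H0; pose proof (HyM (x0 + 1) ltac:(lra)) as H1.
      apply Rabs_le_between in H0; apply Rabs_le_between in H1; lra.
    - intros z Hz _; rewrite E1, E2.
      set (e := exp (- k * (z - x0))).
      assert (He : exp (- k) <= e).
      { unfold e; apply Rlt_le, exp_increasing; nra. }
      assert (Hy : 2 * lambda * y z <= B).
      { eapply Rle_trans; [apply Rle_abs|]; rewrite Rabs_mult; unfold B.
        apply Rmult_le_compat_l; [apply Rabs_pos|apply HyM; lra]. }
      assert (HAk : 0 < A * k) by now apply Rmult_lt_0_compat.
      assert (HAke : A * k * exp (- k) <= A * k * e) by (apply Rmult_le_compat_l; lra).
      assert (HP : Phi (- (A * k ^ 2 * e)) <= s * - (A * k ^ 2 * e)).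
      { apply HPhi; assert (0 < A * k * e * k) by (apply Rmult_lt_0_compat; lra).
        lra. }
      replace (s * - (A * k ^ 2 * e)) with (- (N + 2) * (A * k * e)) in HP
        by (rewrite <- Hsk; ring).
      assert (z * (A * k * e) <= (N + 1) * (A * k * e))
        by (apply Rmult_le_compat_r; lra).
      lra. }
  (* The concave barrier lies below its tangent at [x0], whose slope is [A * k]. *)
  unfold phi in Hle; pose proof (exp_ineq1_le (- k * (x - x0))).
  assert (A * (1 - exp (- k * (x - x0))) <= A * (k * (x - x0)))
    by (apply Rmult_le_compat_l; lra).
  lra.
Qed.

(** The second divided difference of [y] multiplied by [(c - b) * (c - a) * (b - a)]. Free of
    division, it is defined for coinciding points and alternating; its nonnegativity on ordered
    triples is convexity. *)
Definition second_difference (y : R -> R) (a b c : R) : R :=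
  y a * (c - b) + y b * (a - c) + y c * (b - a).

Lemma C2_zero : C2 (fun _ => 0) /\ (forall x, Derive (fun _ => 0) x = 0) /\
  (forall x, Derive (Derive (fun _ : R => 0)) x = 0).
Proof.
  apply (C2_intro (fun _ => 0) (fun _ => 0) (fun _ => 0)); intros x.
  - apply @is_derive_const.
  - apply @is_derive_const.
  - apply continuous_const.
Qed.

(** On a short interval [y] stays below its chord raised by a parabola: the Lipschitz bound controls
    the slope of the chord, so the concavity of the parabola outweighs the lower-order terms. *)
Lemma visc_sub_ODE_semiconvex Phi s lambda (y : R -> R) N L :
  0 < s -> (forall a, a <= 0 -> Phi a <= s * a) ->
  visc_sub_ODE Phi lambda y -> (forall x, continuity_pt y x) -> 0 < N -> 0 <= L ->
  (forall x0 x, - N <= x0 <= N -> x0 <= x <= x0 + 1 -> Rabs (y x - y x0) <= L * (x - x0)) ->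
  exists C d, 0 <= C /\ 0 < d /\
    forall a b c, - N <= a -> a < b < c -> c <= N -> c - a <= d ->
      - (C * ((c - b) * (c - a) * (b - a))) <= second_difference y a b c.
Proof.
  intros Hs HPhi Hsub Hc HN HL HLip.
  destruct (continuity_bounded y (- N) N Hc) as [M [HM HyM]].
  set (B := Rabs (2 * lambda) * M).
  assert (HB : 0 <= B) by (apply Rmult_le_pos; [apply Rabs_pos|lra]).
  (* The terms are at most [-2 * s * C], [N * L + s * C] and [B]; their sum is -1. *)
  set (C := (N * L + B + 1) / s).
  assert (HNL : 0 <= N * L) by (apply Rmult_le_pos; lra).
  assert (HC : 0 < C) by (apply Rdiv_lt_0_compat; lra).
  assert (HsC : s * C = N * L + B + 1) by (unfold C; field; lra).
  (* Length 1 is the range of the Lipschitz bound; length [s / N] keeps the first-order contribution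
     of the parabola below [s * C]. *)
  exists C, (Rmin 1 (s / N)); split; [lra|split].
  { apply Rmin_glb_lt; [lra|apply Rdiv_lt_0_compat; lra]. }
  intros a b c Ha Hb Hcn Hd.
  assert (Hd1 : c - a <= 1) by (eapply Rle_trans; [exact Hd|apply Rmin_l]).
  assert (Hd2 : N * (c - a) <= s).
  { apply Rle_trans with (N * (s / N)); [|right; field; lra].
    apply Rmult_le_compat_l; [lra|].
    eapply Rle_trans; [exact Hd|apply Rmin_r]. }
  set (m := (y c - y a) / (c - a)).
  assert (Hm : m * (c - a) = y c - y a) by (unfold m; field; lra).
  assert (HmL : Rabs m <= L).
  { unfold m; rewrite Rabs_div, (Rabs_pos_eq (c - a)) by lra.
    apply Rle_div_l; [lra|apply HLip; lra]. }
  destruct C2_zero as (H0 & E01 & E02).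
  destruct (C2_quadratic_barrier _ (y a) m C a c H0) as (HC2 & E1 & E2).
  set (phi := fun z => 0 + (y a + m * (z - a) + C * ((z - a) * (c - z)))) in *.
  assert (Hle : y b <= phi b).
  { apply (visc_sub_ODE_comparison Phi lambda y phi a c); auto; try lra.
    - unfold phi; lra.
    - unfold phi; lra.
    - intros z Hz _; rewrite E1, E2, E01, E02.
      assert (Hy : 2 * lambda * y z <= B).
      { eapply Rle_trans; [apply Rle_abs|]; rewrite Rabs_mult; unfold B.
        apply Rmult_le_compat_l; [apply Rabs_pos|apply HyM; lra]. }
      assert (HP : Phi (0 + -2 * C) <= s * (0 + -2 * C)) by (apply HPhi; lra).
      assert (Hz' : z * (0 + (m + C * (a + c - 2 * z))) <= N * (L + C * (c - a))).
      { eapply Rle_trans; [apply Rle_abs|]; rewrite Rabs_mult.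
        apply Rmult_le_compat; try apply Rabs_pos; [apply Rabs_le; lra|].
        rewrite Rplus_0_l; eapply Rle_trans; [apply Rabs_triang|].
        apply Rplus_le_compat; [exact HmL|].
        rewrite Rabs_mult, (Rabs_pos_eq C) by lra.
        apply Rmult_le_compat_l; [lra|apply Rabs_le; lra]. }
      assert (C * (N * (c - a)) <= C * s) by (apply Rmult_le_compat_l; lra).
      lra. }
  unfold phi in Hle; unfold second_difference.
  assert (y b * (c - a) <= (0 + (y a + m * (b - a) + C * ((b - a) * (c - b)))) * (c - a))
    by (apply Rmult_le_compat_r; lra).
  assert (m * (b - a) * (c - a) = (y c - y a) * (b - a)) by (rewrite <- Hm; ring).
  lra.
Qed.

(** * Regularity from bounded second differences *)

(** The second difference and the product of gaps both change sign under transpositions, and both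
    vanish when two points coincide. *)
Lemma second_difference_bound_unordered (y : R -> R) (P : R -> Prop) C :
  (forall a b c, P a -> P b -> P c -> a < b < c ->
     Rabs (second_difference y a b c) <= C * Rabs ((c - b) * (c - a) * (b - a))) ->
  forall a b c, P a -> P b -> P c ->
    Rabs (second_difference y a b c) <= C * Rabs ((c - b) * (c - a) * (b - a)).
Proof.
  intros H.
  set (Q := fun a b c =>
    Rabs (second_difference y a b c) <= C * Rabs ((c - b) * (c - a) * (b - a))).
  assert (S1 : forall a b c, Q a b c -> Q b a c).
  { unfold Q; intros a b c.
    replace (second_difference y b a c) with (- second_difference y a b c)
      by (unfold second_difference; ring).
    replace ((c - a) * (c - b) * (a - b)) with (- ((c - b) * (c - a) * (b - a))) by ring.
    now rewrite !Rabs_Ropp. }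
  assert (S2 : forall a b c, Q a b c -> Q a c b).
  { unfold Q; intros a b c.
    replace (second_difference y a c b) with (- second_difference y a b c)
      by (unfold second_difference; ring).
    replace ((b - c) * (b - a) * (c - a)) with (- ((c - b) * (c - a) * (b - a))) by ring.
    now rewrite !Rabs_Ropp. }
  assert (E : forall a c, Q a a c).
  { unfold Q, second_difference; intros a c.
    replace (y a * (c - a) + y a * (a - c) + y c * (a - a)) with 0 by ring.
    replace ((c - a) * (c - a) * (a - a)) with 0 by ring.
    rewrite Rabs_R0; lra. }
  assert (Hord : forall a b c, P a -> P b -> P c -> a < b < c -> Q a b c) by exact H.
  intros a b c Pa Pb Pc; fold (Q a b c).
  destruct (Rtotal_order a b) as [Hab|[->|Hab]]; [|apply E|];
  (destruct (Rtotal_order b c) as [Hbc|[->|Hbc]]; [|apply S1, S2, E|]).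
  all: try (destruct (Rtotal_order a c) as [Hac|[->|Hac]]; [|apply S2, E|]).
  all: solve [ lra | apply Hord; auto; lra | apply S1, Hord; auto; lra
       | apply S2, Hord; auto; lra | apply S1, S2, Hord; auto; lra
       | apply S2, S1, Hord; auto; lra | apply S1, S2, S1, Hord; auto; lra ].
Qed.

Definition slope (y : R -> R) (a b : R) : R := (y b - y a) / (b - a).

Lemma slope_sym y a b : a <> b -> slope y a b = slope y b a.
Proof. intros Hab; unfold slope; field; lra. Qed.

Section BoundedSecondDifference.

Variables (y : R -> R) (lo hi C : R).
Hypothesis HC : 0 <= C.
Hypothesis Hsd : forall a b c, lo < a < hi -> lo < b < hi -> lo < c < hi ->
  Rabs (second_difference y a b c) <= C * Rabs ((c - b) * (c - a) * (b - a)).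

(** The difference of the two slopes, times [(c - x) * (b - x)], is exactly
    [second_difference y x b c]. *)
Lemma slope_lipschitz x b c : lo < x < hi -> lo < b < hi -> lo < c < hi ->
  b <> x -> c <> x -> Rabs (slope y x c - slope y x b) <= C * Rabs (c - b).
Proof.
  intros Hx Hb Hc Hbx Hcx.
  assert (Hp : 0 < Rabs ((c - x) * (b - x))).
  { apply Rabs_pos_lt, Rmult_integral_contrapositive; lra. }
  apply Rmult_le_reg_r with (1 := Hp).
  rewrite <- Rabs_mult.
  replace ((slope y x c - slope y x b) * ((c - x) * (b - x)))
    with (second_difference y x b c) by (unfold slope, second_difference; field; lra).
  eapply Rle_trans; [now apply Hsd|].
  right; rewrite (Rmult_assoc C), <- Rabs_mult; f_equal; f_equal; ring.
Qed.

(** By [slope_lipschitz] the slopes at [x] satisfy the Cauchy criterion, so they converge; letting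
    one of the two points tend to [x] in the same lemma gives the estimate. *)
Lemma bounded_second_difference_derive x : lo < x < hi ->
  ex_derive y x /\
  forall z, lo < z < hi -> z <> x -> Rabs (slope y x z - Derive y x) <= C * Rabs (z - x).
Proof.
  intros Hx.
  assert (Hd0 : 0 < Rmin (x - lo) (hi - x)) by (apply Rmin_glb_lt; lra).
  set (d0 := mkposreal _ Hd0).
  assert (Hin : forall h, Rabs h < d0 -> lo < x + h < hi).
  { intros h Hh; apply Rabs_def2 in Hh; simpl in Hh.
    pose proof (Rmin_l (x - lo) (hi - x)); pose proof (Rmin_r (x - lo) (hi - x)); lra. }
  assert (Hlim : exists l : R,
            filterlim (fun h => slope y x (x + h)) (locally' 0) (locally l)).
  { apply (proj1 (filterlim_locally_cauchy (U := R_CompleteSpace)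
             (F := Rbar_locally' (Finite 0)) (fun h => slope y x (x + h)))).
    intros eps.
    (* Two increments below this size give slopes closer than [eps]; [C + 1] keeps the denominator
       positive when [C = 0]. *)
    assert (He : 0 < eps / (2 * (C + 1))).
    { apply Rdiv_lt_0_compat; [apply cond_pos|lra]. }
    exists (fun h => h <> 0 /\ Rabs h < d0 /\ Rabs h < eps / (2 * (C + 1))); split.
    - assert (Hd1 : 0 < Rmin d0 (eps / (2 * (C + 1)))).
      { apply Rmin_glb_lt; [apply cond_pos|exact He]. }
      exists (mkposreal _ Hd1); intros h Hh Hh0.
      change (Rabs (h - 0) < Rmin d0 (eps / (2 * (C + 1)))) in Hh.
      rewrite Rminus_0_r in Hh; split; [exact Hh0|split].
      + eapply Rlt_le_trans; [exact Hh|apply Rmin_l].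
      + eapply Rlt_le_trans; [exact Hh|apply Rmin_r].
    - intros h k (Hh0 & Hh1 & Hh2) (Hk0 & Hk1 & Hk2).
      change (Rabs (slope y x (x + k) - slope y x (x + h)) < eps).
      eapply Rle_lt_trans; [apply slope_lipschitz; auto; lra|].
      assert (Hkh : Rabs (x + k - (x + h)) <= Rabs k + Rabs h).
      { replace (x + k - (x + h)) with (k + - h) by ring.
        rewrite <- (Rabs_Ropp h); apply Rabs_triang. }
      apply Rle_lt_trans with (C * (eps / (2 * (C + 1)) + eps / (2 * (C + 1)))).
      { apply Rmult_le_compat_l; lra. }
      replace (C * (eps / (2 * (C + 1)) + eps / (2 * (C + 1))))
        with (eps - eps / (C + 1)) by (field; lra).
      assert (0 < eps / (C + 1)) by (apply Rdiv_lt_0_compat; [apply cond_pos|lra]).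
      lra. }
  destruct Hlim as [l Hl].
  assert (Hl' : forall eps : posreal, exists d : posreal, forall h,
            Rabs h < d -> h <> 0 -> Rabs (slope y x (x + h) - l) < eps).
  { intros eps; destruct (proj1 (filterlim_locally _ _) Hl eps) as [d Hd].
    exists d; intros h Hh Hh0; apply Hd; [|exact Hh0].
    change (Rabs (h - 0) < d); now rewrite Rminus_0_r. }
  assert (Hder : is_derive y x l).
  { apply is_derive_Reals; intros eps Heps.
    destruct (Hl' (mkposreal eps Heps)) as [d Hd]; exists d; intros h Hh0 Hh.
    specialize (Hd h Hh Hh0); unfold slope in Hd.
    now replace (x + h - x) with h in Hd by ring. }
  split; [now exists l|].
  rewrite (is_derive_unique _ _ _ Hder).
  intros z Hz Hzx; apply le_epsilon; intros eps Heps.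
  assert (He : 0 < eps / (2 * (C + 1))) by (apply Rdiv_lt_0_compat; lra).
  destruct (Hl' (pos_div_2 (mkposreal eps Heps))) as [d Hd]; simpl in Hd.
  (* A concrete increment inside the interval: its slope is within [eps / 2] of [l], and replacing
     [x] by [x + h] in the Lipschitz bound costs at most [eps / 2]. *)
  set (h := Rmin (Rmin d d0) (eps / (2 * (C + 1))) / 2).
  assert (Hh : 0 < h /\ h < d /\ h < d0 /\ h < eps / (2 * (C + 1))).
  { pose proof (Rmin_l (Rmin d d0) (eps / (2 * (C + 1)))).
    pose proof (Rmin_r (Rmin d d0) (eps / (2 * (C + 1)))).
    pose proof (Rmin_l d d0); pose proof (Rmin_r d d0).
    assert (0 < Rmin (Rmin d d0) (eps / (2 * (C + 1)))).
    { apply Rmin_glb_lt; [apply Rmin_glb_lt; apply cond_pos|exact He]. }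
    unfold h; lra. }
  assert (Hha : Rabs h = h) by (apply Rabs_pos_eq; lra).
  assert (Hslope := slope_lipschitz x (x + h) z Hx
                      (Hin h ltac:(lra)) Hz ltac:(lra) Hzx).
  specialize (Hd h ltac:(lra) ltac:(lra)).
  replace (slope y x z - l)
    with ((slope y x z - slope y x (x + h)) + (slope y x (x + h) - l)) by ring.
  eapply Rle_trans; [apply Rabs_triang|].
  assert (Hzh : Rabs (z - (x + h)) <= Rabs (z - x) + h).
  { replace (z - (x + h)) with ((z - x) + - h) by ring.
    eapply Rle_trans; [apply Rabs_triang|]; rewrite Rabs_Ropp; lra. }
  assert (HCh : C * h <= eps / 2).
  { apply Rle_trans with (C * (eps / (2 * (C + 1)))).
    - apply Rmult_le_compat_l; lra.
    - replace (C * (eps / (2 * (C + 1)))) with (eps / 2 - eps / (2 * (C + 1)))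
        by (field; lra). lra. }
  assert (C * Rabs (z - (x + h)) <= C * (Rabs (z - x) + h))
    by (apply Rmult_le_compat_l; lra).
  lra.
Qed.

(** The derivatives at [x] and at [z] both differ from their common slope by at most
    [C * Rabs (z - x)], so the derivative is Lipschitz with constant [2 * C]. *)
Lemma bounded_second_difference_derive_continuous x :
  lo < x < hi -> continuous (Derive y) x.
Proof.
  intros Hx.
  destruct (bounded_second_difference_derive x Hx) as [_ Hxs].
  apply filterlim_locally; intros eps.
  assert (Hd : 0 < Rmin (Rmin (x - lo) (hi - x)) (eps / (2 * C + 1))).
  { apply Rmin_glb_lt; [apply Rmin_glb_lt; lra|].
    apply Rdiv_lt_0_compat; [apply cond_pos|lra]. }
  exists (mkposreal _ Hd); intros z Hz.
  change (Rabs (z - x) < Rmin (Rmin (x - lo) (hi - x)) (eps / (2 * C + 1))) in Hz.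
  change (Rabs (Derive y z - Derive y x) < eps).
  destruct (Req_dec z x) as [->|Hzx].
  { unfold Rminus; rewrite Rplus_opp_r, Rabs_R0; apply cond_pos. }
  pose proof (Rlt_le_trans _ _ _ Hz (Rmin_l _ _)) as Hz1.
  pose proof (Rlt_le_trans _ _ _ Hz (Rmin_r _ _)) as Hz2.
  pose proof (Rmin_l (x - lo) (hi - x)); pose proof (Rmin_r (x - lo) (hi - x)).
  assert (Hzin : lo < z < hi) by (apply Rabs_def2 in Hz1; lra).
  specialize (Hxs z Hzin Hzx).
  destruct (bounded_second_difference_derive z Hzin) as [_ Hzs].
  specialize (Hzs x Hx ltac:(congruence)).
  rewrite (slope_sym y z x Hzx), (Rabs_minus_sym x z) in Hzs.
  replace (Derive y z - Derive y x)
    with (- (slope y x z - Derive y z) + (slope y x z - Derive y x)) by ring.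
  eapply Rle_lt_trans; [apply Rabs_triang|]; rewrite Rabs_Ropp.
  apply Rle_lt_trans with ((2 * C) * Rabs (z - x)); [lra|].
  apply Rle_lt_trans with ((2 * C) * (eps / (2 * C + 1))).
  { apply Rmult_le_compat_l; lra. }
  replace (2 * C * (eps / (2 * C + 1))) with (eps - eps / (2 * C + 1)) by (field; lra).
  assert (0 < eps / (2 * C + 1)) by (apply Rdiv_lt_0_compat; [apply cond_pos|lra]).
  lra.
Qed.

End BoundedSecondDifference.

Lemma second_difference_opp (y : R -> R) a b c :
  second_difference (fun z => - y z) a b c = - second_difference y a b c.
Proof. unfold second_difference; ring. Qed.

(** Each one-sided estimate is applied to [y] and to [- y]: the first pair gives a two-sided
    Lipschitz bound, the second a two-sided bound on second differences. *)
Lemma visc_ODE_C1 Phi Psi s lambda (y : R -> R) :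
  0 < s -> (forall a, a <= 0 -> Phi a <= s * a) -> (forall a, a <= 0 -> Psi a <= s * a) ->
  (forall x, continuity_pt y x) ->
  visc_sub_ODE Phi lambda y -> visc_sub_ODE Psi lambda (fun z => - y z) ->
  forall x, ex_derive y x /\ continuous (Derive y) x.
Proof.
  intros Hs HPhi HPsi Hc Hsub Hsuper x.
  assert (Hc' : forall x, continuity_pt (fun z => - y z) x)
    by (intros; now apply continuity_pt_opp).
  (* Leaves a margin of 1 around [x] inside the interval from [- N] to [N]. *)
  set (N := Rabs x + 1).
  assert (HN : 0 < N) by (pose proof (Rabs_pos x); unfold N; lra).
  destruct (visc_sub_ODE_upper_lipschitz Phi s lambda y N) as [L1 HL1]; auto.
  destruct (visc_sub_ODE_upper_lipschitz Psi s lambda (fun z => - y z) N) as [L2 HL2]; auto.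
  set (L := Rmax 0 (Rmax L1 L2)).
  assert (HL : 0 <= L) by apply Rmax_l.
  assert (HLip : forall x0 x, - N <= x0 <= N -> x0 <= x <= x0 + 1 ->
            Rabs (y x - y x0) <= L * (x - x0)).
  { intros x0 z Hx0 Hz.
    assert (L1 <= L /\ L2 <= L).
    { unfold L; pose proof (Rmax_l L1 L2); pose proof (Rmax_r L1 L2).
      pose proof (Rmax_r 0 (Rmax L1 L2)); lra. }
    assert (L1 * (z - x0) <= L * (z - x0)) by (apply Rmult_le_compat_r; lra).
    assert (L2 * (z - x0) <= L * (z - x0)) by (apply Rmult_le_compat_r; lra).
    specialize (HL1 x0 z Hx0 Hz); specialize (HL2 x0 z Hx0 Hz).
    apply Rabs_le; lra. }
  destruct (visc_sub_ODE_semiconvex Phi s lambda y N L)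
    as (C1 & d1 & HC1 & Hd1 & H1); auto.
  destruct (visc_sub_ODE_semiconvex Psi s lambda (fun z => - y z) N L)
    as (C2 & d2 & HC2 & Hd2 & H2); auto.
  { intros x0 z Hx0 Hz; rewrite <- Rabs_Ropp.
    replace (- (- y z - - y x0)) with (y z - y x0) by ring; now apply HLip. }
  (* Halved because a triple taken within [d] of [x] spans up to [2 * d]. *)
  set (d := Rmin 1 (Rmin d1 d2) / 2).
  assert (Hd : 0 < d /\ d <= 1 /\ 2 * d <= d1 /\ 2 * d <= d2).
  { unfold d; pose proof (Rmin_l 1 (Rmin d1 d2)); pose proof (Rmin_r 1 (Rmin d1 d2)).
    pose proof (Rmin_l d1 d2); pose proof (Rmin_r d1 d2).
    assert (0 < Rmin 1 (Rmin d1 d2)) by (repeat apply Rmin_glb_lt; lra).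
    lra. }
  assert (Hx : - N + 1 <= x <= N - 1).
  { unfold N; pose proof (Rle_abs x); pose proof (Rle_abs (- x)).
    rewrite Rabs_Ropp in *; lra. }
  assert (HC : 0 <= C1 + C2) by lra.
  assert (Hsd : forall a b c, x - d < a < x + d -> x - d < b < x + d -> x - d < c < x + d ->
    Rabs (second_difference y a b c) <= (C1 + C2) * Rabs ((c - b) * (c - a) * (b - a))).
  { apply (second_difference_bound_unordered y (fun z => x - d < z < x + d)).
    intros a b c Ha Hb Hcc Habc.
    specialize (H1 a b c ltac:(lra) Habc ltac:(lra) ltac:(lra)).
    specialize (H2 a b c ltac:(lra) Habc ltac:(lra) ltac:(lra)).
    rewrite second_difference_opp in H2.
    assert (Hp : 0 <= (c - b) * (c - a) * (b - a))
      by (repeat apply Rmult_le_pos; lra).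
    rewrite (Rabs_pos_eq _ Hp).
    assert (0 <= C1 * ((c - b) * (c - a) * (b - a))) by now apply Rmult_le_pos.
    assert (0 <= C2 * ((c - b) * (c - a) * (b - a))) by now apply Rmult_le_pos.
    apply Rabs_le; lra. }
  split.
  - apply (bounded_second_difference_derive y (x - d) (x + d) _ HC Hsd); lra.
  - apply (bounded_second_difference_derive_continuous y (x - d) (x + d) _ HC Hsd); lra.
Qed.

(** * From [C^1] to [C^2] *)

Lemma C2_second_primitive (f : R -> R) : (forall x, continuous f x) ->
  exists Y, C2 Y /\ forall x, Derive (Derive Y) x = f x.
Proof.
  intros Hf.
  assert (Hprim : forall g : R -> R, (forall x, continuous g x) ->
            forall x, is_derive (RInt g 0) x (g x)).
  { intros g Hg x; apply (is_derive_RInt g (RInt g 0) 0 x); [|apply Hg].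
    exists (mkposreal 1 Rlt_0_1); intros z _.
    apply (RInt_correct (V := R_CompleteNormedModule)), (ex_RInt_continuous (V := R_CompleteNormedModule)).
    intros v _; apply Hg. }
  exists (RInt (RInt f 0) 0).
  edestruct (C2_intro (RInt (RInt f 0) 0) (RInt f 0) f) as (H1 & _ & H2).
  - apply Hprim; intros x; apply (ex_derive_continuous (RInt f 0)).
    exists (f x); now apply Hprim.
  - now apply Hprim.
  - exact Hf.
  - now split.
Qed.

(** [Y] solves the equation with the lower-order terms frozen at [y]. Adding to [Y] the chord of
    [y - Y] and a small concave parabola gives a strict supersolution wherever it is tested, so
    [y - Y] lies below its chords up to an error that tends to 0. *)
Lemma visc_sub_ODE_minus_primitive_convex Phi lambda (y Y : R -> R) :
  (forall a b, a < b -> Phi a < Phi b) ->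
  visc_sub_ODE Phi lambda y -> (forall x, ex_derive y x) -> C2 Y ->
  (forall x, Phi (Derive (Derive Y) x) + x * Derive y x + 2 * lambda * y x = 0) ->
  forall a b c, a < b < c -> 0 <= second_difference (fun z => y z - Y z) a b c.
Proof.
  intros HPhi Hsub Hy HY Heq a b c Habc.
  set (w := fun z => y z - Y z).
  set (m := (w c - w a) / (c - a)).
  assert (Hm : m * (c - a) = w c - w a) by (unfold m; field; lra).
  apply le_epsilon; intros eps Heps.
  set (P := (b - a) * (c - b) * (c - a)).
  assert (HP : 0 < P) by (unfold P; repeat apply Rmult_lt_0_compat; lra).
  assert (Hq : 0 < eps / P) by (apply Rdiv_lt_0_compat; lra).
  (* After multiplication by [c - a] the parabola contributes [q * P], which is exactly [eps]. *)
  set (q := eps / P) in *.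
  assert (HqP : q * P = eps) by (unfold q; field; lra).
  destruct (C2_quadratic_barrier Y (w a) m q a c HY) as (HC2 & E1 & E2).
  set (phi := fun z => Y z + (w a + m * (z - a) + q * ((z - a) * (c - z)))) in *.
  assert (Hle : y b <= phi b).
  { apply (visc_sub_ODE_comparison Phi lambda y phi a c); auto; try lra.
    - intros x; now apply ex_derive_continuity_pt.
    - unfold phi, w; lra.
    - unfold phi; rewrite Hm; unfold w; lra.
    - intros z Hz Hloc.
      assert (Hphi : ex_derive phi z) by apply HC2.
      apply (Derive_eq0_local_max (fun v => y v - phi v)) in Hloc;
        [|exact (ex_derive_minus y phi z (Hy z) Hphi)].
      rewrite (Derive_minus y phi z (Hy z) Hphi) in Hloc.
      (* At the contact point the lower-order terms become those of the equation for [Y]; only the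
         second-order terms differ, by [-2 * q] inside the increasing [Phi]. *)
      replace (Derive phi z) with (Derive y z) by (apply Rminus_diag_uniq; exact Hloc).
      rewrite E2, <- (Heq z).
      apply Rplus_lt_compat_r, Rplus_lt_compat_r, HPhi; lra. }
  assert (Hw : w b <= w a + m * (b - a) + q * ((b - a) * (c - b)))
    by (unfold phi in Hle; unfold w at 1; lra).
  assert (w b * (c - a) <= (w a + m * (b - a) + q * ((b - a) * (c - b))) * (c - a))
    by (apply Rmult_le_compat_r; lra).
  assert (m * (b - a) * (c - a) = (w c - w a) * (b - a)) by (rewrite <- Hm; ring).
  unfold P in HqP; unfold second_difference; lra.
Qed.

Lemma F_continuous sigma a : continuous (F sigma) a.
Proof.
  apply continuous_ext with
    (fun a => (1 - sigma ^ 2) / 2 * Rabs a + (1 + sigma ^ 2) / 2 * a).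
  { intros x; destruct (Rle_dec 0 x).
    - rewrite F_nonneg, Rabs_pos_eq by lra; simpl; lra.
    - rewrite F_nonpos, Rabs_left by lra; simpl; lra. }
  apply (continuous_plus (fun a => (1 - sigma ^ 2) / 2 * Rabs a)
           (fun a => (1 + sigma ^ 2) / 2 * a)).
  - apply (continuous_scal_r ((1 - sigma ^ 2) / 2) Rabs), continuous_Rabs.
  - apply (ex_derive_continuous (fun a => (1 + sigma ^ 2) / 2 * a)).
    auto_derive; trivial.
Qed.

(** The inverse of [F sigma] belongs to the same family: on the negative side the slopes are
    reciprocal, and the sign is preserved. *)
Lemma F_inv sigma b : 0 < sigma -> F sigma (F (/ sigma) b) = b.
Proof.
  intros Hs; destruct (Rle_dec 0 b).
  - now rewrite !F_nonneg by (rewrite ?F_nonneg; lra).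
  - assert (0 < / sigma) by now apply Rinv_0_lt_compat.
    rewrite (F_nonpos (/ sigma)) by lra.
    rewrite F_nonpos by nra; field; lra.
Qed.

Lemma ODE_of_visc sigma lambda (H : R -> R) : 0 < sigma < 1 ->
  (forall x, continuity_pt H x) ->
  visc_sub_ODE (F sigma) lambda H ->
  visc_sub_ODE (fun a => - F sigma (- a)) lambda (fun z => - H z) ->
  C2_solution_ODE sigma lambda H.
Proof.
  intros Hs Hc Hsub Hsuper.
  assert (Hs2 : 0 < sigma ^ 2 < 1) by nra.
  assert (HC1 : forall x, ex_derive H x /\ continuous (Derive H) x).
  { apply (visc_ODE_C1 (F sigma) (fun a => - F sigma (- a)) (sigma ^ 2) lambda); auto; try lra.
    - intros a Ha; rewrite F_nonpos by lra; lra.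
    (* On negative arguments the reflected nonlinearity is the identity, which lies below
       [sigma ^ 2 * a] because [sigma ^ 2 < 1]. *)
    - intros a Ha; rewrite F_nonneg by lra; nra. }
  set (h := fun x => - (x * Derive H x + 2 * lambda * H x)).
  assert (Hh : forall x, continuous h x).
  { intros x; apply (continuous_opp (fun x => x * Derive H x + 2 * lambda * H x)).
    apply (continuous_plus (fun x => x * Derive H x) (fun x => 2 * lambda * H x)).
    - apply (continuous_mult (fun x => x) (Derive H)); [apply continuous_id|apply HC1].
    - apply (continuous_scal_r (2 * lambda) H), (ex_derive_continuous H), HC1. }
  destruct (C2_second_primitive (fun x => F (/ sigma) (h x))) as (Y & HY & EY).
  { intros x; apply (continuous_comp h (F (/ sigma))); [apply Hh|apply F_continuous]. }
  assert (HFY : forall x, F sigma (Derive (Derive Y) x) = h x).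
  { intros x; rewrite EY; apply F_inv; lra. }
  destruct (C2_scal_shift Y (-1) 0 HY) as (HY' & _ & EY').
  assert (Hcv := visc_sub_ODE_minus_primitive_convex (F sigma) lambda H Y
    (fun a b => F_increasing sigma a b Hs) Hsub (fun x => proj1 (HC1 x)) HY
    ltac:(intros x; rewrite HFY; unfold h; ring)).
  (* The same lemma for the reflected equation, where [- Y] is the second primitive; the function
     found to be convex is [Y - H]. *)
  assert (Hcc : forall a b c, a < b < c ->
            0 <= second_difference (fun z => - H z - (-1 * Y z + 0)) a b c).
  { apply (visc_sub_ODE_minus_primitive_convex (fun a => - F sigma (- a)) lambda); auto.
    - intros a b Hab; apply Ropp_lt_contravar, F_increasing; [assumption|lra].
    - intros x; apply (ex_derive_opp H), HC1.
    - intros x; rewrite EY', (Derive_opp H).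
      replace (- (-1 * Derive (Derive Y) x)) with (Derive (Derive Y) x) by ring.
      rewrite HFY; unfold h; ring. }
  set (w := fun z => H z - Y z) in *.
  (* Convexity of [w] and [- w] is a second-difference bound with constant 0; dropping the order of
     the points allows 0, 1 and an arbitrary [z]. *)
  assert (Hw0 : forall a b c, Rabs (second_difference w a b c)
                              <= 0 * Rabs ((c - b) * (c - a) * (b - a))).
  { intros a b c.
    apply (second_difference_bound_unordered w (fun _ => True)); trivial.
    clear a b c; intros a b c _ _ _ Habc.
    specialize (Hcv a b c Habc); specialize (Hcc a b c Habc).
    unfold second_difference, w in *; rewrite Rmult_0_l; apply Rabs_le; lra. }
  (* [w] is the affine interpolation of its values at 0 and 1, written in the form of
     [C2_quadratic_barrier] with zero parabola. *)
  assert (HH : forall z, Y z + (w 0 + (w 1 - w 0) * (z - 0) + 0 * ((z - 0) * (0 - z))) = H z).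
  { intros z; specialize (Hw0 0 1 z); rewrite Rmult_0_l in Hw0.
    assert (E : second_difference w 0 1 z = 0).
    { destruct (Req_dec (second_difference w 0 1 z) 0) as [E|E]; [exact E|].
      apply Rabs_pos_lt in E; lra. }
    unfold second_difference in E.
    assert (w z = H z - Y z) by reflexivity; lra. }
  destruct (C2_quadratic_barrier Y (w 0) (w 1 - w 0) 0 0 0 HY) as (HHY & E1 & E2).
  assert (E1' : forall x, Derive H x = Derive Y x + (w 1 - w 0)).
  { intros x; rewrite <- (Derive_ext _ _ x HH), E1; ring. }
  assert (E2' : forall x, Derive (Derive H) x = Derive (Derive Y) x).
  { intros x.
    rewrite <- (Derive_ext _ _ x (fun v => Derive_ext _ _ v HH)), E2; ring. }
  split.
  - intros x; split; [apply HC1|split].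
    + apply (ex_derive_ext (fun x => Derive Y x + (w 1 - w 0)));
        [intros; now rewrite E1'|].
      apply (ex_derive_plus (Derive Y)); [apply HY|apply ex_derive_const].
    + apply continuous_ext with (Derive (Derive Y)); [intros; now rewrite E2'|apply HY].
  - intros x; fold (F sigma (Derive (Derive H) x)); rewrite E2', HFY; unfold h; ring.
Qed.

Theorem theorem3p1 (sigma lambda : R)
  (Hsigma : 0 < sigma < 1) (Hlambda : 0 < lambda < 1 / 2) (H : R -> R) :
  C2_solution_ODE sigma lambda H <-> G_heat_solution sigma H (uH lambda H).
Proof.
  split; [now apply G_heat_solution_of_ODE|].
  intros (Hcont & Hsub & Hsuper & _); apply ODE_of_visc; [assumption| | |].
  - now apply (continuity_of_half_plane lambda).
  - now apply visc_sub_ODE_of_uH.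
  - now apply visc_super_ODE_of_uH.
Qed.
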